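(* Let $n\ge 3$, let $\mathbf{m}=(m_1,\dots,m_n)\in\mathbb{R}^n_{>0}$ be non-dominating, and let $G$ be the complete graph on $n$ vertices weighted by $\mathbf{m}$. Then the MAXCUT SDP of $G$ admits an optimal solution $\mathbf{X}_G$ with $$\operatorname{rank}(\mathbf{X}_G)=n-1\qquad\text{and}\qquad \frac14\langle \mathcal{L}_G,\mathbf{X}_G\rangle=\frac14\left(\sum_{i=1}^n m_i\right)^2 .$$
   Context: A vector $\mathbf{m}\in\mathbb{R}^n_{>0}$ ($n\ge3$) is non-dominating if $m_j<\sum_{k\neq j}m_k$ for every $j\in[n]=\{1,\dots,n\}$. The complete graph $K_n$ on vertex set $[n]$ is weighted by $\mathbf{m}$ if its edge weights are $w_{ij}=m_im_j$ for all $i\ne j$. The Laplacian $\mathcal{L}_G$ of a graph $G=(V,E)$ with edge weights $w_{ij}$ ($w_{ij}=0$ for non-edges) is the $V\times V$ matrix with off-diagonal entries $-w_{ij}$ and diagonal entries $\sum_{j\ne i}w_{ij}$. The MAXCUT SDP of $G$ is: maximize $\frac14\langle \mathcal{L}_G,\mathbf{X}\rangle$ over symmetric matrices $\mathbf{X}\in\mathbb{R}^{V\times V}$ with $X_{ii}=1$ for all $i\in V$ and $\mathbf{X}\succeq \mathbf{0}$, where $\langle \mathbf{A},\mathbf{B}\rangle=\operatorname{tr}(\mathbf{A}\mathbf{B})$. *)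

(* Defs.v *)
From HB Require Import structures.
From mathcomp Require Import all_boot all_order all_algebra.
From mathcomp Require Import reals.

Set Implicit Arguments.
Unset Strict Implicit.
Unset Printing Implicit Defensive.

Import Order.TTheory GRing.Theory Num.Theory.
Local Open Scope ring_scope.

(* A simple graph on the vertex set 'I_n with real edge weights; the weight
   function is extended by 0 to the non-edges. *)
Record wgraph (R : realType) (n : nat) := WGraph {
  adj : rel 'I_n;
  weight : 'I_n -> 'I_n -> R;
  adj_sym : symmetric adj;
  adj_irrefl : irreflexive adj;
  weight_sym : forall i j, weight i j = weight j i;
  weight_nonedge : forall i j, ~~ adj i j -> weight i j = 0
}.

Section CompleteGraph.
Context {R : realType} {n : nat} (m : 'rV[R]_n).

Definition complete_adj : rel 'I_n := fun i j => i != j.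

Definition complete_weight (i j : 'I_n) : R :=
  if i == j then 0 else m 0 i * m 0 j.

Fact complete_adj_sym : symmetric complete_adj.
Proof. by move=> i j; rewrite /complete_adj eq_sym. Qed.

Fact complete_adj_irrefl : irreflexive complete_adj.
Proof. by move=> i; rewrite /complete_adj eqxx. Qed.

Fact complete_weight_sym i j : complete_weight i j = complete_weight j i.
Proof. by rewrite /complete_weight eq_sym mulrC. Qed.

Fact complete_weight_nonedge i j :
  ~~ complete_adj i j -> complete_weight i j = 0.
Proof. by rewrite /complete_adj /complete_weight negbK => ->. Qed.

Definition weighted_complete : wgraph R n :=
  WGraph complete_adj_sym complete_adj_irrefl
         complete_weight_sym complete_weight_nonedge.

End CompleteGraph.

Definition non_dominating {R : realType} {n : nat} (m : 'rV[R]_n) : Prop :=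
  forall j : 'I_n, m 0 j < \sum_(k < n | k != j) m 0 k.

Definition laplacian {R : realType} {n : nat} (G : wgraph R n) : 'M[R]_n :=
  \matrix_(i, j) (if i == j then \sum_(k < n | k != i) weight G i k
                  else - weight G i j).

Definition mxinner {R : realType} {n : nat} (A B : 'M[R]_n) : R :=
  \tr (A *m B).

Definition psdmx {R : realType} {n : nat} (X : 'M[R]_n) : Prop :=
  X^T = X /\ forall u : 'cV[R]_n, 0 <= (u^T *m X *m u) 0 0.

Definition maxcut_sdp_feasible {R : realType} {n : nat} (X : 'M[R]_n) : Prop :=
  (forall i : 'I_n, X i i = 1) /\ psdmx X.

Definition maxcut_sdp_objective {R : realType} {n : nat} (G : wgraph R n)
    (X : 'M[R]_n) : R :=
  4%:R^-1 * mxinner (laplacian G) X.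

Definition maxcut_sdp_optimal {R : realType} {n : nat} (G : wgraph R n)
    (X : 'M[R]_n) : Prop :=
  maxcut_sdp_feasible X /\
  forall Y : 'M[R]_n, maxcut_sdp_feasible Y ->
    maxcut_sdp_objective G Y <= maxcut_sdp_objective G X.

(* Main.v *)
Require Import Defs.
From HB Require Import structures.
From mathcomp Require Import all_boot all_order all_algebra.
From mathcomp Require Import reals topology normedtype realfun.
From mathcomp Require Import ring lra.

Import Order.TTheory GRing.Theory Num.Theory.
Import numFieldNormedType.Exports.
Local Open Scope ring_scope.

(** For a matrix [X] with unit diagonal the diagonal terms of the pairing of the
    Laplacian with [X] complete the square, and the pairing equals
    [(\sum_i m_i)^2 - m X m^T] ([objective_unit_diagonal]).  On feasible
    matrices the objective is therefore at most a quarter of [(\sum_i m_i)^2],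
    with equality as soon as [m X = 0].  What has to be found is a positive
    semidefinite [X] with unit diagonal whose kernel is exactly the line spanned
    by [m] ([exists_unit_diagonal_kernel]): its rank is then [n - 1].

    Write [X = D^-1 Y D^-1] with [D] the diagonal matrix of [m].  The conditions
    on [Y] are that it is positive semidefinite, that its diagonal is [m_i^2],
    and that its kernel is the line of constant vectors.  Let [o] be a vertex of
    maximal weight, and look for [Y] as the Laplacian of a star centred at [o]
    plus a rank-one term,
      [x Y x^T = 2 \sum_(i != o) q_i y_i^2 + u (\sum_(i != o) q_i y_i)^2]
    where [y_i = x_i - x_o], with positive [q_i] and a real [u] of any sign.
    Constant vectors are in the kernel.  By the Cauchy-Schwarz inequality the
    form is positive definite in [y] once [2 + u Q > 0], where
    [Q = \sum_(i != o) q_i] ([star_form_ge]), so nothing else is in the kernel.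
    The diagonal conditions read
      [2 q_i + u q_i^2 = m_i^2] for [i != o], and [2 Q + u Q^2 = m_o^2].
    Choosing in each quadratic of the first group the root that stays bounded as
    [u] tends to 0 makes every [q_i] a continuous function of [u]; the last
    equation is solved by the intermediate value theorem, and this is where
    the hypothesis that [o] does not dominate is used
    ([exists_star_weights]). *)

(** The degree of vertex [i] is [m_i] times the sum of the other entries of [m],
    so the missing squares [m_i^2 X_ii = m_i^2] cancel between the two terms of
    the right-hand side. *)
Lemma objective_unit_diagonal (R : realType) (n : nat) (m : 'rV[R]_n)
    (X : 'M[R]_n) : (forall i, X i i = 1) ->
  mxinner (laplacian (weighted_complete m)) X =
    (\sum_i m 0 i) ^+ 2 - (m *m X *m m^T) 0 0.
Proof.
move=> X1.
have -> : (m *m X *m m^T) 0 0 = \sum_i \sum_j m 0 i * m 0 j * X j i.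
  rewrite mxE; apply: eq_bigr => i _; rewrite !mxE mulr_suml.
  by apply: eq_bigr => j _; ring.
rewrite /mxinner /mxtrace expr2 mulr_suml -sumrB; apply: eq_bigr => i _.
rewrite mxE mulr_sumr -sumrB (bigD1 i) //= [RHS](bigD1 i) //= mxE eqxx !X1.
rewrite !mulr1 subrr add0r -big_split /=; apply: eq_bigr => j ji.
by rewrite mxE /= /complete_weight eq_sym (negPf ji); ring.
Qed.

(** Up to the factor [Q = \sum_i q_i], the difference of the two sides is the
    variance-like sum of the [q_i (Q y_i - \sum_j q_j y_j)^2]. *)
Lemma weighted_cauchy_schwarz (R : realFieldType) (I : finType) (P : pred I)
    (q y : I -> R) : (forall i, P i -> 0 < q i) ->
  (\sum_(i | P i) q i * y i) ^+ 2
    <= (\sum_(i | P i) q i) * \sum_(i | P i) q i * y i ^+ 2.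
Proof.
move=> q_gt0; set A := \sum_(i | P i) q i * y i; set Q := \sum_(i | P i) q i.
have Q_ge0 : 0 <= Q by apply: sumr_ge0 => i /q_gt0 /ltW.
have := Q_ge0; rewrite le_eqVlt => /orP[/eqP Q0|Q_gt0].
  have /psumr_eq0P q0 : Q = 0 by [].
  have -> : A = 0.
    by rewrite /A big1 // => i Pi; rewrite q0 ?mul0r // => j /q_gt0 /ltW.
  by rewrite expr0n /= -Q0 mul0r.
have : 0 <= \sum_(i | P i) q i * (Q * y i - A) ^+ 2.
  by apply: sumr_ge0 => i /q_gt0 /ltW qi; rewrite mulr_ge0 ?sqr_ge0.
have -> : \sum_(i | P i) q i * (Q * y i - A) ^+ 2 =
    Q * (Q * (\sum_(i | P i) q i * y i ^+ 2) - A ^+ 2).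
  transitivity (\sum_(i | P i) (Q ^+ 2 * (q i * y i ^+ 2) -
      2 * Q * A * (q i * y i) + A ^+ 2 * q i)).
    by apply: eq_bigr => i _; ring.
  by rewrite big_split sumrB /= -!mulr_sumr -/A -/Q; ring.
by rewrite pmulr_rge0 // subr_ge0.
Qed.

(** If [u >= 0], the rank-one term can be dropped; if [u < 0], Cauchy-Schwarz
    bounds it below by [u Q \sum_i q_i y_i^2].  The two cases give the two
    arguments of the minimum. *)
Lemma star_form_ge (R : realFieldType) (I : finType) (P : pred I)
    (q y : I -> R) (u : R) : (forall i, P i -> 0 < q i) ->
  Num.min 2 (2 + u * \sum_(i | P i) q i) * (\sum_(i | P i) q i * y i ^+ 2)
   <= 2 * (\sum_(i | P i) q i * y i ^+ 2) + u * (\sum_(i | P i) q i * y i) ^+ 2.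
Proof.
move=> q_gt0; have := weighted_cauchy_schwarz R I P q y q_gt0.
set A := \sum_(i | P i) q i * y i; set Q := \sum_(i | P i) q i.
set S := \sum_(i | P i) _ => AQS.
have S_ge0 : 0 <= S.
  by apply: sumr_ge0 => i /q_gt0 /ltW qi; rewrite mulr_ge0 ?sqr_ge0.
case: (lerP 0 u) => [u_ge0|u_lt0].
  apply: (@le_trans _ _ (2 * S)); first by rewrite ler_wpM2r // ge_min lexx.
  by rewrite lerDl mulr_ge0 ?sqr_ge0.
apply: (@le_trans _ _ ((2 + u * Q) * S)).
  by rewrite ler_wpM2r // ge_min lexx orbT.
by rewrite mulrDl lerD2l -mulrA ler_nM2l.
Qed.

(** Put [M = m_o].  Solving the quadratic equation for [q_i] gives
    [q_i = m_i^2 / (1 + sqrt (1 + m_i^2 u))], a form that also makes sense at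
    [u = 0].  The equation for [Q] says that [(1 + u Q)^2 = 1 + M^2 u], where
    either square root may be the right one for [1 + u Q].  Taking this signed
    root [p] as the parameter instead of [u], so that [u = (p^2 - 1) / M^2],
    puts both branches on the single interval [p > -1], on which
    [2 + u Q = 1 + p] is positive.  It remains to solve [(1 + p) Q(p) = M^2]:
    the left-hand side vanishes at [p = -1] and tends to
    [M \sum_(i != o) m_i > M^2] as [p] grows.  Maximality of [m_o] keeps the
    square roots real for [|p| < 1]. *)
Lemma exists_star_weights (R : realType) (I : finType) (o : I) (m : I -> R) :
    (forall i, 0 < m i) -> (forall i, m i <= m o) ->
    m o < \sum_(i | i != o) m i ->
  exists u : R, exists q : I -> R,
    [/\ forall i, i != o -> 0 < q i,
        forall i, i != o -> 2 * q i + u * q i ^+ 2 = m i ^+ 2,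
        2 * (\sum_(i | i != o) q i) + u * (\sum_(i | i != o) q i) ^+ 2
          = m o ^+ 2 &
        0 < 2 + u * \sum_(i | i != o) q i].
Proof.
move=> m_gt0 m_le m_nd; set M := m o in m_le m_nd *.
have M_gt0 : 0 < M by apply: m_gt0.
have m_ge0 i : 0 <= m i by apply: ltW.
have M_ge0 : 0 <= M by apply: ltW.
pose u (p : R) : R := (p ^+ 2 - 1) / M ^+ 2.
pose t (p : R) i : R := Num.sqrt (1 + m i ^+ 2 * u p).
pose q (p : R) i : R := m i ^+ 2 / (1 + t p i).
have t_ge0 p i : 0 <= t p i by apply: sqrtr_ge0.
have t1_gt0 p i : 0 < 1 + t p i by rewrite ltr_pwDl.
have q_gt0 p i : 0 < q p i by rewrite divr_gt0 ?exprn_gt0.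
have tE p i : t p i ^+ 2 = 1 + m i ^+ 2 * u p.
  rewrite sqr_sqrtr //.
  have -> : 1 + m i ^+ 2 * u p =
      (M ^+ 2 - m i ^+ 2 + m i ^+ 2 * p ^+ 2) / M ^+ 2.
    by rewrite /u; field; apply: lt0r_neq0.
  rewrite divr_ge0 ?sqr_ge0 // addr_ge0 //; last by rewrite -exprMn sqr_ge0.
  by rewrite subr_ge0 ler_sqr ?nnegrE ?(ltW (m_gt0 _)).
have qE p i : 2 * q p i + u p * q p i ^+ 2 = m i ^+ 2.
  have t1_neq0 := lt0r_neq0 (t1_gt0 p i).
  have -> : 2 * q p i + u p * q p i ^+ 2 =
      m i ^+ 2 * (2 * (1 + t p i) + m i ^+ 2 * u p) / (1 + t p i) ^+ 2.
    by rewrite /q; field.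
  have -> : m i ^+ 2 * u p = t p i ^+ 2 - 1 by rewrite tE; ring.
  by field.
pose Q (p : R) : R := \sum_(i | i != o) q p i.
pose h (p : R) : R := (1 + p) * Q p.
have h_cont : continuous h.
  move=> x; apply: cvgM; first by apply: cvgD; [exact: cvg_cst|exact: cvg_id].
  rewrite /Q; apply: cvg_big => [|i _]; first exact: add_continuous.
  apply: cvgM; first exact: cvg_cst.
  apply: cvgV; first exact: lt0r_neq0.
  apply: cvgD; first exact: cvg_cst.
  apply: (@continuous_comp _ _ _ (fun y => 1 + m i ^+ 2 * u y) Num.sqrt);
    last exact: sqrt_continuous.
  apply: cvgD; first exact: cvg_cst.
  apply: cvgM; first exact: cvg_cst.
  apply: cvgM; last exact: cvg_cst.
  by apply: cvgB; [apply: cvgM; exact: cvg_id|exact: cvg_cst].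
set S := \sum_(i | i != o) m i in m_nd.
(* The lower bound [q_lb] loses at most [2 * M / B] for each vertex; [B] is
   large enough for the total loss to stay below [S - M]. *)
pose B := (2 * M * #|I|%:R + 1) / (S - M).
have SM_gt0 : 0 < S - M by rewrite subr_gt0.
have B_gt0 : 0 < B.
  by rewrite divr_gt0 // ltr_wpDl // !mulr_ge0.
have B_ge0 : 0 <= B by apply: ltW.
have q_lb i : M * (m i - 2 * M / B) <= (1 + B) * q B i.
  have t_le : t B i <= 1 + m i * B / M.
    rewrite -(@ler_sqr R) ?nnegrE //; last first.
      by rewrite addr_ge0 // divr_ge0 // mulr_ge0.
    rewrite tE -subr_ge0.
    have -> : (1 + m i * B / M) ^+ 2 - (1 + m i ^+ 2 * u B) =
        2 * (m i * B / M) + (m i / M) ^+ 2.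
      by rewrite /u; field; apply: lt0r_neq0.
    by rewrite addr_ge0 ?sqr_ge0 // mulr_ge0 // divr_ge0 // mulr_ge0.
  rewrite /q mulrA ler_pdivlMr //.
  (* With [sqrt (1 + m_i^2 u) <= 1 + m_i B / M], cross-multiplying requires a
     nonnegative left factor; otherwise the bound is trivial. *)
  have [c0|c_gt0] := lerP (m i - 2 * M / B) 0.
    apply: (@le_trans _ _ 0).
      by rewrite mulr_le0_ge0 ?mulr_ge0_le0 // addr_ge0.
    by rewrite mulr_ge0 ?sqr_ge0 // addr_ge0.
  apply: (@le_trans _ _ (M * (m i - 2 * M / B) * (1 + (1 + m i * B / M)))).
    by rewrite ler_pM2l ?mulr_gt0 // lerD2l.
  rewrite -subr_ge0.
  have -> : (1 + B) * m i ^+ 2 - M * (m i - 2 * M / B) * (1 + (1 + m i * B / M))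
     = m i ^+ 2 + 4 * M ^+ 2 / B.
    by field; rewrite !lt0r_neq0.
  by rewrite addr_ge0 ?sqr_ge0 // divr_ge0 // mulr_ge0 ?sqr_ge0.
have hB : M ^+ 2 <= h B.
  apply: (@le_trans _ _ (\sum_(i | i != o) M * (m i - 2 * M / B))); last first.
    by rewrite /h /Q mulr_sumr; apply: ler_sum.
  rewrite -mulr_sumr expr2 ler_pM2l // sumrB -/S.
  rewrite sumr_const -[_ *+ #|_|]mulr_natl lerBrDr -lerBrDl.
  apply: (@le_trans _ _ (#|I|%:R * (2 * M / B))).
    rewrite ler_wpM2r ?ler_nat ?max_card //.
    by rewrite divr_ge0 // mulr_ge0.
  rewrite mulrA ler_pdivrMr //.
  have -> : (S - M) * B = 2 * M * #|I|%:R + 1 by rewrite mulrC divfK ?lt0r_neq0.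
  by lra.
have [p p_in hp] : exists2 p, p \in `[(-1), B] & h p = M ^+ 2.
  apply: IVT.
  - by apply: (@le_trans _ _ 0); [rewrite oppr_le0|exact: ltW].
  - exact: continuous_subspaceT.
  - by rewrite ge_min le_max hB /h subrr mul0r sqr_ge0 orbT.
have p1_gt0 : 0 < 1 + p.
  rewrite lt_neqAle; move: p_in; rewrite in_itv /= => /andP[p_ge _].
  rewrite -lerBlDl sub0r p_ge andbT; apply/eqP => p0.
  by move: hp; rewrite /h -p0 mul0r => /esym/eqP; rewrite sqrf_eq0 gt_eqF.
have uQ : u p * Q p = p - 1.
  apply: (mulfI (lt0r_neq0 p1_gt0)).
  transitivity (u p * h p); first by rewrite /h; ring.
  by rewrite hp /u; field; apply: lt0r_neq0.
have u2Q : 2 + u p * Q p = 1 + p by rewrite uQ; ring.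
exists (u p), (q p); split=> //; last by rewrite -/(Q p) u2Q.
by rewrite -/(Q p) -hp /h -u2Q; ring.
Qed.

(** The column [f i] is the linear form [v |-> v_i / m_i - v_o / m_o], that is
    [x_i - x_o] for the rescaled vector [x_i = v_i / m_i]; the line spanned by
    [m] is the common kernel of these forms, and [X] is the star form written in
    them.  The last conclusion speaks of isotropic vectors: for a positive
    semidefinite matrix they form the kernel, and this version is directly what
    positive definiteness in the [f i] gives. *)
Lemma exists_unit_diagonal_kernel (R : realType) (n : nat) (m : 'rV[R]_n)
    (o : 'I_n) :
    (forall i, 0 < m 0 i) -> (forall i, m 0 i <= m 0 o) ->
    m 0 o < \sum_(i < n | i != o) m 0 i ->
  exists X : 'M[R]_n,
    [/\ forall i, X i i = 1, psdmx X, m *m X = 0 &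
        forall v : 'rV[R]_n, (v *m X *m v^T) 0 0 = 0 -> (v <= m)%MS].
Proof.
move=> m_gt0 m_le m_nd.
have [u [q [q_gt0 qE QE uQ_gt0]]] :=
  exists_star_weights R _ o (fun i => m 0 i) m_gt0 m_le m_nd.
have m_neq0 i : m 0 i != 0 by apply: lt0r_neq0.
pose f i : 'cV[R]_n := (m 0 i)^-1 *: delta_mx i 0 - (m 0 o)^-1 *: delta_mx o 0.
pose g := \sum_(i | i != o) q i *: f i.
pose X := \sum_(i | i != o) (2 * q i) *: (f i *m (f i)^T) + u *: (g *m g^T).
pose y (v : 'rV[R]_n) i := v 0 i / m 0 i - v 0 o / m 0 o.
have vf v i : v *m f i = (y v i)%:M.
  rewrite mulmxBr -!scalemxAr -!colE [LHS]mx11_scalar !mxE.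
  by congr (_%:M); rewrite /y; ring.
have vg v : v *m g = (\sum_(i | i != o) q i * y v i)%:M.
  rewrite mulmx_sumr rmorph_sum /=; apply: eq_bigr => i _.
  by rewrite -scalemxAr vf scale_scalar_mx.
have X_tr : X^T = X.
  rewrite linearD linearZ linear_sum /= trmx_mul trmxK; congr (_ + _).
  by apply: eq_bigr => i _; rewrite linearZ /= trmx_mul trmxK.
have X_form v : (v *m X *m v^T) 0 0 =
    2 * (\sum_(i | i != o) q i * y v i ^+ 2) +
    u * (\sum_(i | i != o) q i * y v i) ^+ 2.
  have sq (w : 'cV[R]_n) c : v *m w = c%:M ->
      (v *m (w *m w^T) *m v^T) 0 0 = c ^+ 2.
    move=> vw; rewrite mulmxA -mulmxA -trmx_mul vw tr_scalar_mx.
    by rewrite -scalar_mxM mxE eqxx mulr1n.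
  rewrite mulmxDr mulmxDl mxE; congr (_ + _).
    rewrite mulmx_sumr mulmx_suml summxE mulr_sumr; apply: eq_bigr => i _.
    by rewrite -scalemxAr -scalemxAl mxE (sq _ _ (vf v i)) mulrA.
  by rewrite -scalemxAr -scalemxAl mxE (sq _ _ (vg v)).
have X_form_ge v := star_form_ge R _ (fun i => i != o) q (y v) u q_gt0.
set c := Num.min _ _ in X_form_ge.
have c_gt0 : 0 < c by rewrite lt_min ltr0n.
have S_ge0 v : 0 <= \sum_(i | i != o) q i * y v i ^+ 2.
  by apply: sumr_ge0 => i /q_gt0 /ltW qi; rewrite mulr_ge0 ?sqr_ge0.
exists X; split.
- move=> k.
  pose e : 'rV[R]_n := delta_mx 0 k.
  have eE i : e 0 i = (i == k)%:R by rewrite mxE.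
  have -> : X k k = (e *m X *m e^T) 0 0.
    by rewrite trmx_delta -rowE -colE !mxE.
  (* At [e_o] every [y i] equals [- 1 / m_o], which gives the equation for
     [Q]; at any other basis vector only [y k] survives. *)
  rewrite X_form; have [ko|ko] := eqVneq k o.
    have ye i : i != o -> y e i = - (m 0 o)^-1.
      by move=> io; rewrite /y !eE ko eqxx (negPf io) mul0r sub0r div1r.
    set Q := \sum_(i | i != o) q i in QE *.
    have -> : \sum_(i | i != o) q i * y e i ^+ 2 = Q * (m 0 o)^-1 ^+ 2.
      by rewrite mulr_suml; apply: eq_bigr => i io; rewrite ye // sqrrN.
    have -> : \sum_(i | i != o) q i * y e i = Q * - (m 0 o)^-1.
      by rewrite mulr_suml; apply: eq_bigr => i io; rewrite ye.
    transitivity ((2 * Q + u * Q ^+ 2) / m 0 o ^+ 2); first by field.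
    by rewrite QE divff ?expf_neq0.
  have ye i : y e i = (i == k)%:R / m 0 i.
    by rewrite /y !eE (eq_sym o) (negPf ko) mul0r subr0.
  have big_k (F : R -> R) : F 0 = 0 ->
      \sum_(i | i != o) q i * F (y e i) = q k * F (m 0 k)^-1.
    move=> F0; rewrite (bigD1 k) //= big1 ?addr0 => [|i /andP[_ ik]].
      by rewrite ye eqxx mul1r.
    by rewrite ye (negPf ik) mul0r F0 mulr0.
  rewrite (big_k (fun x => x ^+ 2)) ?expr0n // (big_k id) //.
  transitivity ((2 * q k + u * q k ^+ 2) / m 0 k ^+ 2); first by field.
  by rewrite qE // divff ?expf_neq0.
- split=> // w; rewrite -[w in _ *m w]trmxK X_form.
  by apply: le_trans (X_form_ge _); rewrite mulr_ge0 // ltW.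
- have my i : y m i = 0 by rewrite /y !divff ?subrr.
  rewrite mulmxDr mulmx_sumr -scalemxAr mulmxA vg big1 => [|i _]; last first.
    by rewrite -scalemxAr mulmxA vf my raddf0 mul0mx scaler0.
  rewrite big1 => [|i _]; last by rewrite my mulr0.
  by rewrite raddf0 mul0mx scaler0 add0r.
- move=> v; rewrite X_form => v0; move: (X_form_ge v); rewrite v0.
  rewrite pmulr_rle0 // => S_le0.
  have S0 : \sum_(i | i != o) q i * y v i ^+ 2 = 0.
    by apply/eqP; rewrite eq_le S_le0 S_ge0.
  apply/sub_rVP; exists (v 0 o / m 0 o); apply/rowP => i; rewrite mxE.
  have [->|io] := eqVneq i o; first by rewrite divfK.
  have qy_ge0 j : j != o -> 0 <= q j * y v j ^+ 2.
    by move=> /q_gt0 /ltW qj; rewrite mulr_ge0 ?sqr_ge0.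
  have /eqP := psumr_eq0P qy_ge0 S0 io.
  rewrite mulf_eq0 (gt_eqF (q_gt0 _ io)) sqrf_eq0 subr_eq0 => /eqP <-.
  by rewrite divfK.
Qed.

Theorem theorem7 (R : realType) (n : nat) (hn : (3 <= n)%N) (m : 'rV[R]_n)
    (m_gt0 : forall i : 'I_n, 0 < m 0 i) (m_nd : non_dominating m) :
  exists X : 'M[R]_n,
    [/\ maxcut_sdp_optimal (weighted_complete m) X,
        \rank X = (n - 1)%N &
        4%:R^-1 * mxinner (laplacian (weighted_complete m)) X =
          4%:R^-1 * (\sum_(i < n) m 0 i) ^+ 2].
Proof.
pose i0 : 'I_n := Ordinal (ltnW (ltnW hn)).
have [o m_le] : exists o, forall i, m 0 i <= m 0 o.
  case: (@arg_maxP _ _ _ i0 xpredT (m 0)) => // o _ le_o.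
  by exists o => i; apply: le_o.
have [X [X1 X_psd mX kerX]] :=
  exists_unit_diagonal_kernel R n m o m_gt0 m_le (m_nd o).
have X_obj : mxinner (laplacian (weighted_complete m)) X = (\sum_i m 0 i) ^+ 2.
  by rewrite objective_unit_diagonal // mX mul0mx mxE subr0.
exists X; split; last by rewrite X_obj.
- split=> [//|Y [Y1 [_ Y_ge0]]].
  rewrite /maxcut_sdp_objective X_obj objective_unit_diagonal //.
  rewrite ler_pM2l ?invr_gt0 ?ltr0n // gerBl.
  by have := Y_ge0 m^T; rewrite trmxK.
have ker_m : (kermx X :=: m)%MS.
  apply/eqmxP/andP; split; last by apply/sub_kermxP.
  apply/rV_subP => v /sub_kermxP vX; apply: kerX.
  by rewrite vX mul0mx mxE.
have m_neq0 : m != 0.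
  by apply/eqP => m0; have := m_gt0 i0; rewrite m0 mxE ltxx.
have := mxrank_ker X; rewrite ker_m rank_rV m_neq0 => rk.
by rewrite -[1%N]/(nat_of_bool true) rk subKn ?rank_leq_row.
Qed.
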